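(* Let $d\ge1$, $k\ge1$, let $G$ be a $k$-fold $\mathcal{R}_d$-circuit with principal partition $\mathcal{A}$, and let $u,x$ be two technicolour vertices of $G$. Let $G*v$ be the cone of $G$ over a new vertex $v$ (which is a $k$-fold $\mathcal{R}_{d+1}$-circuit). Then the edges $vu$ and $vx$ belong to different parts of the principal partition of $G*v$ (in $\mathcal{R}_{d+1}$) whenever (a) there exists $z\in N_G(u)\cap N_G(x)$ such that $uz$ and $xz$ belong to different parts of $\mathcal{A}$, or (b) $N_G(u)\setminus\{x\}\neq N_G(x)\setminus\{u\}$.
   Context: For a graph $G=(V,E)$ and a generic $p:V\to\mathbb{R}^d$ (coordinates algebraically independent over $\mathbb{Q}$), the rigidity matrix $R(G,p)$ has a row for each $uv\in E$ with $p(u)-p(v)$ in the $d$ columns of $u$, $p(v)-p(u)$ in those of $v$, zeros elsewhere. The generic $d$-dimensional rigidity matroid $\mathcal{R}_d$ is its row matroid, with rank function $r_d$. Graphs are identified with their edge sets. A set of edges is cyclic if it is a union of $\mathcal{R}_d$-circuits. A graph $(V,D)$ is a $k$-fold $\mathcal{R}_d$-circuit if $D$ is cyclic and $r_d(D)=|D|-k$. Its principal partition is the partition $\{A_1,\dots,A_\ell\}$ of $D$ such that $\{D\setminus A_i\}$ is exactly the set of $(k-1)$-fold $\mathcal{R}_d$-circuits contained in $D$. A vertex is technicolour if it is incident with edges from at least two parts of the principal partition. The cone $G*v$ of $G=(V,E)$ is obtained by adding a new vertex $v$ joined to every vertex of $V$. $N_G(u)$ is the neighbourhood of $u$ in $G$.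 *)

(* Defs.v *)
From HB Require Import structures.
From mathcomp Require Import all_boot all_order all_algebra.
From mathcomp Require Import reals.
From mathcomp Require Import mpoly.
Set Implicit Arguments. Unset Strict Implicit. Unset Printing Implicit Defensive.
Import Order.TTheory GRing.Theory Num.Theory.
Local Open Scope ring_scope.

(* Graphs: vertex type T (a finType); an edge is a 2-element subset of T;
   a graph is identified with its edge set D : {set {set T}}.
   A realisation in R^d is p : T -> 'rV[R]_d. *)

Section Rigidity.
Variables (R : realType) (T : finType) (d : nat).

Definition other (e : {set T}) (a : T) : T :=
  odflt a [pick b in e :\ a].

(* Rigidity matrix of the edge set F at p: one row for every potential
   edge e : {set T} (rows of edges outside F are zero), columns indexed by
   pairs (vertex, coordinate).  Row e = {a,b}: p(a)-p(b) in the columns of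
   a, p(b)-p(a) in the columns of b, 0 elsewhere. *)
Definition rigidity_matrix (p : T -> 'rV[R]_d) (F : {set {set T}}) :
    'M[R]_(#|{: {set T}}|, #|{: T * 'I_d}|) :=
  \matrix_(i, j)
    let e := enum_val i in
    let ac := enum_val j in
    if (e \in F) && (ac.1 \in e) then p ac.1 0 ac.2 - p (other e ac.1) 0 ac.2
    else 0.

Definition rig_rank (p : T -> 'rV[R]_d) (F : {set {set T}}) : nat :=
  \rank (rigidity_matrix p F).

Definition coords (p : T -> 'rV[R]_d) (i : 'I_#|{: T * 'I_d}|) : R :=
  let ac := enum_val i in p ac.1 0 ac.2.

Definition generic (p : T -> 'rV[R]_d) : Prop :=
  forall P : {mpoly rat[#|{: T * 'I_d}|]},
    P != 0 -> mmap (fun c : rat => ratr c) (coords p) P != 0.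

Variable p : T -> 'rV[R]_d.

Definition dependent (F : {set {set T}}) : Prop := (rig_rank p F < #|F|)%N.

Definition circuit (C : {set {set T}}) : Prop :=
  dependent C /\ forall C' : {set {set T}}, C' \proper C -> ~ dependent C'.

Definition cyclic (F : {set {set T}}) : Prop :=
  exists CC : {set {set {set T}}},
    (forall C, C \in CC -> circuit C) /\ F = \bigcup_(C in CC) C.

Definition kfold_circuit (k : nat) (D : {set {set T}}) : Prop :=
  cyclic D /\ rig_rank p D + k = #|D|.

Definition principal_partition (k : nat) (D : {set {set T}})
    (P : {set {set {set T}}}) : Prop :=
  partition P D /\
  forall F, (exists2 A, A \in P & F = D :\: A) <->
            (F \subset D /\ kfold_circuit k.-1 F).

End Rigidity.

Section Graphs.
Variable T : finType.

Definition simple_graph (D : {set {set T}}) : Prop :=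
  forall e, e \in D -> #|e| = 2%N.

Definition vertices (D : {set {set T}}) : {set T} :=
  \bigcup_(e in D) e.

Definition nbhd (D : {set {set T}}) (u : T) : {set T} :=
  [set w | [set u; w] \in D].

Definition technicolour (D : {set {set T}}) (P : {set {set {set T}}}) (u : T)
  : Prop :=
  exists e f, [/\ e \in D, f \in D, u \in e, u \in f & pblock P e != pblock P f].

(* cone G * v, the new vertex v being None *)
Definition cone (D : {set {set T}}) : {set {set option T}} :=
  [set [set None; Some a] | a in vertices D] :|: [set (Some @: e : {set option T}) | e : {set T} in D].

End Graphs.

(* Main.v *)
(* Write M for the rigidity matrix. A stress of F is a row vector w supported on F
   with w M = 0, so that |F| minus the rank of F is the dimension of the space of
   stresses of F. Two edges e, f of a cyclic set D lie in the same part of the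
   principal partition exactly when w_e = 0 and w_f = 0 are equivalent for every
   stress w of D.

   Suppose that q sends the apex v and the vertices a so that
   q(a) - q(v) = mu(a)^-1 (1, p(a)). Then the stresses s of (D, p) correspond to
   those of the cone by w_ab = mu(a) mu(b) s_ab, w_va = mu(a) L_a(s), where
   L_a(s) = sum_z s_az (mu(a) - mu(z)). Since a generic realisation has the least
   nullity on every edge set, it suffices to find one nowhere zero mu for which
   L_u and L_x are linearly independent on the stresses of (D, p).
   In case (a) take mu = 1 + delta_z: then L_u(s) = - s_uz and L_x(s) = - s_xz.
   In case (b) let z be adjacent to u but not to x, and (as x is technicolour) let
   xy be an edge outside the part of uz; then mu = 1 + delta_y + r delta_z works
   for r = 0 or r = 1. *)
Require Import Defs.
From HB Require Import structures.
From mathcomp Require Import all_boot all_order all_algebra.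
From mathcomp Require Import reals.
From mathcomp Require Import mpoly.
From mathcomp Require Import zify ring.
Set Implicit Arguments. Unset Strict Implicit. Unset Printing Implicit Defensive.
Import Order.TTheory GRing.Theory Num.Theory.

(** * Stresses, cyclic parts and coparallel classes of a row matroid *)

Section Stress.
Local Open Scope ring_scope.
Variables (K : fieldType) (E : finType) (n : nat) (M : 'M[K]_(#|E|, n)).

Definition coef (w : 'rV[K]_#|E|) (e : E) : K := w 0 (enum_rank e).

(** A diagonal projection whose row space consists of the vectors supported on [F]. *)
Definition mask_mx (F : {set E}) : 'M[K]_#|E| :=
  diag_mx (\row_i (enum_val i \in F)%:R).

Definition stress (F : {set E}) : 'M[K]_#|E| := (mask_mx F :&: kermx M)%MS.

Definition nullity (F : {set E}) : nat := \rank (stress F).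

(** [F] without its coloops, that is, the union of the circuits inside [F]; the cyclic sets are its
    fixed points. *)
Definition core (F : {set E}) : {set E} :=
  [set e in F | (nullity (F :\ e) < nullity F)%N].

Implicit Types (D F G : {set E}) (w : 'rV[K]_#|E|).

Lemma coef_inj w1 w2 : coef w1 =1 coef w2 -> w1 = w2.
Proof. by move=> h; apply/rowP => i; have := h (enum_val i); rewrite /coef enum_valK. Qed.

Lemma coef_mask w F e : coef (w *m mask_mx F) e = (e \in F)%:R * coef w e.
Proof. by rewrite /coef mul_mx_diag !mxE enum_rankK mulrC. Qed.

Lemma sub_mask w F : reflect (forall e, e \notin F -> coef w e = 0) (w <= mask_mx F)%MS.
Proof.
apply: (iffP idP) => [/submxP[a ->] e /negbTE he|h]; first by rewrite coef_mask he mul0r.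
suff -> : w = w *m mask_mx F by exact: submxMl.
apply: coef_inj => e; rewrite coef_mask.
by case: (boolP (e \in F)) => [_|/h ->]; rewrite ?mul1r ?mulr0.
Qed.

Lemma stressP w F :
  reflect ((forall e, e \notin F -> coef w e = 0) /\ w *m M = 0) (w <= stress F)%MS.
Proof.
rewrite sub_capmx; apply: (iffP andP).
  by case=> /sub_mask h /sub_kermxP.
by case=> h k; split; [apply/sub_mask | apply/sub_kermxP].
Qed.

Lemma rank_mask F : \rank (mask_mx F) = #|F|.
Proof.
pose f (i : 'I_#|F|) := enum_rank (enum_val i : E).
have f_inj : injective f by move=> i j /enum_rank_inj/enum_val_inj.
have /eqP <- : row_free (rowsub f 1%:M : 'M[K]_(_, #|E|)).
  apply/row_freeP; exists (rowsub f 1%:M)^T; apply/matrixP => i j.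
  rewrite mxE (bigD1 (f i)) //= big1 => [|l /negbTE li].
    by rewrite !mxE eqxx addr0 mul1r (inj_eq f_inj) eq_sym.
  by rewrite !mxE eq_sym li mul0r.
apply/eqmx_rank; apply/andP; split; apply/row_subP => i.
  rewrite /mask_mx row_diag_mx mxE; case: (boolP (enum_val i \in F)) => h;
    last by rewrite scale0r sub0mx.
  have -> : i = f (enum_rank_in h (enum_val i)) by rewrite /f enum_rankK_in // enum_valK.
  by rewrite scale1r -row1 -row_rowsub row_sub.
rewrite row_rowsub row1; apply/sub_mask => e eF; rewrite /coef mxE eqxx (inj_eq enum_rank_inj).
by case: eqP eF => // ->; rewrite enum_valP.
Qed.

Lemma rank_nullity F : (\rank (mask_mx F *m M) + nullity F)%N = #|F|.
Proof. by rewrite /nullity /stress mxrank_mul_ker rank_mask. Qed.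

Lemma stressS F G : F \subset G -> (stress F <= stress G)%MS.
Proof.
move=> sFG; apply/rV_subP => v /stressP[h k]; apply/stressP; split=> // e eG.
by apply: h; apply: contraNN eG; exact: (subsetP sFG).
Qed.

Lemma stress_setD1 F e w :
  (w <= stress (F :\ e))%MS = (w <= stress F)%MS && (coef w e == 0).
Proof.
apply/idP/andP => [h|[/stressP[h1 h2] /eqP h3]].
  split; first by rewrite (submx_trans h) ?stressS ?subD1set.
  by case/stressP: h => -> //; rewrite !inE eqxx.
apply/stressP; split=> // f; rewrite !inE negb_and negbK.
by case/orP => [/eqP -> //|/h1].
Qed.

Lemma nullity_setD1_lt F e w :
  (w <= stress F)%MS -> coef w e != 0 -> (nullity (F :\ e) < nullity F)%N.
Proof.
move=> hw he; apply: rank_ltmx; rewrite ltmxE stressS ?subD1set //=.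
apply: contra he => h; have := submx_trans hw h.
by rewrite stress_setD1 => /andP[].
Qed.

Lemma nullity_setD1_ltP F e :
  reflect (exists2 w, (w <= stress F)%MS & coef w e != 0)
          (nullity (F :\ e) < nullity F)%N.
Proof.
apply: (iffP idP) => [h|[w]]; last exact: nullity_setD1_lt.
have : ~~ (stress F <= stress (F :\ e))%MS.
  by apply: contraL h => /mxrankS; rewrite -leqNgt.
case/row_subPn => i; rewrite stress_setD1 row_sub /= => hsub.
by exists (row i (stress F)); rewrite ?row_sub.
Qed.

(** Rank and nullity add up to the number of edges, and a deletion cannot raise the rank. *)
Lemma nullity_setD1_ge F e : (nullity F <= (nullity (F :\ e)).+1)%N.
Proof.
have h : (\rank (mask_mx (F :\ e) *m M) <= \rank (mask_mx F *m M))%N.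
  have -> : mask_mx (F :\ e) = mask_mx (F :\ e) *m mask_mx F.
    rewrite /mask_mx mulmx_diag; congr diag_mx; apply/rowP => i.
    by rewrite !mxE !inE -natrM mulnb -andbA andbb.
  by rewrite -mulmxA mxrankM_maxr.
have := rank_nullity F; have := rank_nullity (F :\ e); have := cardsD1 e F.
lia.
Qed.

Lemma coreP F e :
  reflect (exists2 w, (w <= stress F)%MS & coef w e != 0) (e \in core F).
Proof.
rewrite inE; apply: (iffP andP) => [[_ /nullity_setD1_ltP]|h] //; split; last exact/nullity_setD1_ltP.
by case: h => w /stressP[hw _]; apply: contraR => /hw ->.
Qed.

Lemma core_sub F : core F \subset F.
Proof. by apply/subsetP => e; rewrite inE => /andP[]. Qed.

Lemma stress_core F : (stress (core F) :=: stress F)%MS.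
Proof.
apply/eqmxP; rewrite stressS ?core_sub //=; apply/rV_subP => v hv.
case/stressP: (hv) => h1 h2; apply/stressP; split=> // e.
by apply: contraNeq => he; apply/coreP; exists v.
Qed.

Lemma nullity_core F : nullity (core F) = nullity F.
Proof. by rewrite /nullity stress_core. Qed.

Lemma eq_core F G : (stress F :=: stress G)%MS -> core F = core G.
Proof.
by move=> h; apply/setP => e; apply/coreP/coreP => -[w hw he]; exists w; rewrite // ?h // -h.
Qed.

Lemma core_idem F : core (core F) = core F.
Proof. by apply: eq_core; exact: stress_core. Qed.

Lemma nullity_core_setD1 D e : core D = D -> e \in D -> nullity D = (nullity (D :\ e)).+1.
Proof.
move=> cD eD; apply/eqP; rewrite eqn_leq nullity_setD1_ge /=.
by move: eD; rewrite -{1}cD inE => /andP[].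
Qed.

(** Nested stress spaces of equal dimension coincide, and [core] depends on the stress space
    only. *)
Lemma core_same_nullity F G :
  F \subset G -> nullity F = nullity G -> core F = core G.
Proof.
move=> sFG h; apply: eq_core; apply/eqmxP; rewrite stressS //=.
by rewrite -(mxrank_leqif_sup (stressS sFG)) -/(nullity F) -/(nullity G) h.
Qed.

(* When [D] is cyclic, the dual of the matroid restricted to [D] has no loop, and
   these are its parallel classes. *)
Definition coparallel (D : {set E}) (e : E) : {set E} := D :\: core (D :\ e).

Lemma coparallel_id D e : e \in D -> e \in coparallel D e.
Proof. by move=> eD; rewrite !inE eqxx eD. Qed.

(** Every stress vanishing at [e] also vanishes at [f]. Both deletions lower the nullity by exactly
    one, so the inclusion of their stress spaces is an equality. *)
Lemma coparallel_eq D e f :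
  core D = D -> e \in D -> f \in coparallel D e -> coparallel D f = coparallel D e.
Proof.
move=> cD eD; rewrite !inE => /andP[he fD].
rewrite /coparallel; congr (_ :\: _).
have h : (stress (D :\ e) <= stress (D :\ f))%MS.
  apply/rV_subP => w hw; rewrite stress_setD1.
  move: (hw); rewrite stress_setD1 => /andP[-> _] /=.
  apply: contraR he => hf; apply/andP.
  by have /coreP : exists2 w, (w <= stress (D :\ e))%MS & coef w f != 0;
    [exists w | rewrite !inE => /andP[]].
apply: eq_core; apply: eqmx_sym; apply/eqmxP; rewrite h /=.
have := nullity_core_setD1 cD eD; rewrite (nullity_core_setD1 cD fD) => -[] hn.
by rewrite -(mxrank_leqif_sup h) -/(nullity _) -/(nullity _) hn.
Qed.

Definition coparallel_classes D := [set coparallel D e | e in D].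

Lemma coparallel_partition D : core D = D -> partition (coparallel_classes D) D.
Proof.
move=> cD; apply/and3P; split.
- apply/eqP/setP => f; apply/bigcupP/idP => [[_ /imsetP[e eD ->]]|fD].
    by rewrite inE => /andP[].
  by exists (coparallel D f); rewrite ?coparallel_id // imset_f.
- apply/trivIsetP => _ _ /imsetP[e eD ->] /imsetP[f fD ->]; apply: contraR.
  case/pred0Pn => g /andP[/= ge gf].
  by rewrite -(coparallel_eq cD eD ge) (coparallel_eq cD fD gf).
- apply/negP => /imsetP[e eD h]; have := coparallel_id eD.
  by rewrite -h inE.
Qed.

(** A cyclic [F] of nullity [k.-1] misses some edge [e]; it has the nullity of [D :\ e] and lies
    inside it, hence is its core. *)
Lemma core_nullity_predP D k F : core D = D -> nullity D = k -> (0 < k)%N ->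
  (exists2 B, B \in coparallel_classes D & F = D :\: B) <->
  (F \subset D /\ core F = F /\ nullity F = k.-1).
Proof.
move=> cD nD k0; split.
  case=> _ /imsetP[e eD ->] ->; have sc : core (D :\ e) \subset D.
    exact: subset_trans (core_sub _) (subD1set _ _).
  rewrite /coparallel setDDr setDv set0U (setIidPr sc); split=> //; split.
    exact: core_idem.
  by rewrite nullity_core -nD (nullity_core_setD1 cD eD).
case=> sFD [cF nF].
(* Here [0 < k] matters: it makes [k.-1] differ from [k], so [F] is not [D]. *)
have /subsetPn[e eD eF] : ~~ (D \subset F).
  apply/negP => sDF; move: nF; have -> : F = D by apply/eqP; rewrite eqEsubset sFD.
  by rewrite nD; case: (k) k0 => // m _ /esym; lia.
exists (coparallel D e); first exact: imset_f.
have sF : F \subset D :\ e by rewrite subsetD1 sFD.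
have sc : core (D :\ e) \subset D.
  exact: subset_trans (core_sub _) (subD1set _ _).
rewrite /coparallel setDDr setDv set0U (setIidPr sc) -{1}cF.
by apply: core_same_nullity => //; rewrite nF -nD (nullity_core_setD1 cD eD).
Qed.

End Stress.

(** * Circuits and the principal partition in terms of stresses *)

Section Framework.
Local Open Scope ring_scope.
Variables (R : realType) (T : finType) (d : nat) (p : T -> 'rV[R]_d).
Implicit Types (F C D : {set {set T}}) (Q : {set {set {set T}}}).

Let M := rigidity_matrix p setT.

Lemma rigidity_matrixE F : rigidity_matrix p F = mask_mx R F *m M.
Proof.
apply/matrixP => i j; rewrite /mask_mx mul_diag_mx !mxE /= in_setT /=.
by case: (_ \in F); rewrite ?mul1r ?mul0r.
Qed.

Lemma rig_rank_nullity F : (rig_rank p F + nullity M F)%N = #|F|.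
Proof. by rewrite /rig_rank rigidity_matrixE rank_nullity. Qed.

Lemma dependentP F : dependent p F <-> (0 < nullity M F)%N.
Proof. by have := rig_rank_nullity F; rewrite /dependent; split; lia. Qed.

Lemma dependentP_stress F :
  dependent p F <-> exists2 w : 'rV[R]_#|{: {set T}}|, (w <= stress M F)%MS & w != 0.
Proof.
rewrite dependentP lt0n mxrank_eq0; split => [/rowV0Pn[w]|[w]] h1 h2.
  by exists w.
by apply/rowV0Pn; exists w.
Qed.

(* A stress of minimal support among those that do not vanish at [e] is
   supported by a circuit. *)
Lemma stress_circuit F w e : (w <= stress M F)%MS -> coef w e != 0 ->
  exists C, [/\ circuit p C, e \in C & C \subset F].
Proof.
have [m hm] := ubnP #|F|; elim: m => // m IH in F w hm *.
move=> hw he.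
have eF : e \in F by case/stressP: hw => h _; apply: contraR he => /h ->.
case: (boolP [exists f in F, (f != e) && (e \in core M (F :\ f))]).
  case/exists_inP => f fF /andP[fe /coreP[v hv hve]].
  have sF := subD1set F f.
  have [|C [hC eC sC]] := IH (F :\ f) v _ hv hve.
    by move: hm; rewrite (cardsD1 f F) fF.
  by exists C; split=> //; exact: subset_trans sC sF.
move/exists_inPn => h; exists F; split=> //; split.
  by apply/dependentP_stress; exists w => //; apply: contraNneq he => ->; rewrite /coef mxE.
move=> C' /properP[sC [f fF fC]] /dependentP_stress[v hv v0].
have : (v <= stress M (F :\ f))%MS.
  by apply: submx_trans hv _; apply: stressS; rewrite subsetD1 sC.
have [g vg] : exists g, coef v g != 0.
  apply/existsP; apply: contraNT v0 => /existsPn h0; apply/eqP/coef_inj => g.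
  by have := h0 g; rewrite negbK => /eqP ->; rewrite /coef mxE.
move=> hv'; have ve : coef v e = 0.
  have [ef|fe] := eqVneq f e.
    by move: hv'; rewrite stress_setD1 ef => /andP[_ /eqP].
  have := h _ fF; rewrite fe /=; apply: contraNeq => ve; by apply/coreP; exists v.
have hvF : (v <= stress M F)%MS by apply: submx_trans hv' _; exact/stressS/subD1set.
have gF : g \in F by case/stressP: hvF => h0 _; apply: contraR vg => /h0 ->.
have ge : g != e by apply: contraNneq vg => ->; rewrite ve.
(* Subtracting this multiple of [v] cancels the coefficient at [g] and keeps the one at [e], where
   [v] vanishes; this contradicts [h]. *)
have := h _ gF; rewrite ge /= => /coreP[]; exists (w - (coef w g / coef v g) *: v).
  rewrite stress_setD1; apply/andP; split.
    by rewrite addmx_sub // -scaleNr scalemx_sub.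
  by move: vg; rewrite /coef !mxE => vg; rewrite divfK // subrr.
by move: ve he; rewrite /coef !mxE => ->; rewrite mulr0 subr0.
Qed.

(** By minimality, a nonzero stress of a circuit vanishes at none of its edges. Conversely, each
    edge carrying a stress lies in a circuit, and one is chosen per edge. *)
Lemma cyclicP F : cyclic p F <-> core M F = F.
Proof.
split=> [[CC [hC eF]]|cF].
  apply/eqP; rewrite eqEsubset core_sub /=; apply/subsetP => e.
  rewrite {1}eF => /bigcupP[C CCC eC]; have [dC mC] := hC _ CCC.
  have sCF : C \subset F by rewrite eF; exact: bigcup_sup.
  have /dependentP_stress[w hw w0] := dC.
  apply/coreP; exists w; first exact: submx_trans (stressS _ sCF).
  apply/eqP => we; apply: (mC (C :\ e)); first exact: properD1.
  by apply/dependentP_stress; exists w; rewrite // stress_setD1 hw we eqxx.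
have [f hf] : exists f : {set T} -> {set {set T}},
    forall e, e \in F -> [/\ circuit p (f e), e \in f e & f e \subset F].
  apply: (@fin_all_exists _ _
    (fun e (C : {set {set T}}) => e \in F -> [/\ circuit p C, e \in C & C \subset F])) => e.
  case: (boolP (e \in F)) => eF; last by exists set0.
  move: eF; rewrite -{1}cF => /coreP[w hw he].
  by have [C hC] := stress_circuit hw he; exists C.
exists [set f e | e in F]; split=> [_ /imsetP[e /hf[h _ _] ->]|] //.
apply/setP => e; apply/idP/bigcupP => [eF|[_ /imsetP[g /hf[_ _ /subsetP h] ->]]]; last exact: h.
by exists (f e); [exact: imset_f | case: (hf _ eF)].
Qed.

Lemma kfold_circuitP k F : kfold_circuit p k F <-> core M F = F /\ nullity M F = k.
Proof.
rewrite /kfold_circuit cyclicP -(rig_rank_nullity F).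
by split=> -[-> h]; split=> //; move: h; lia.
Qed.

Lemma coparallel_principal k D : (0 < k)%N -> kfold_circuit p k D ->
  principal_partition p k D (coparallel_classes M D).
Proof.
move=> k0 /kfold_circuitP[cD nD]; split; first exact: coparallel_partition.
move=> F; rewrite kfold_circuitP; exact: core_nullity_predP.
Qed.

(** The complements of the parts are prescribed, and a part is the complement of its complement in
    [D]. *)
Lemma principal_partition_uniq k D Q Q' :
  principal_partition p k D Q -> principal_partition p k D Q' -> Q = Q'.
Proof.
have sub Q1 Q2 : principal_partition p k D Q1 -> principal_partition p k D Q2 -> Q1 \subset Q2.
  move=> [p1 h1] [p2 h2]; apply/subsetP => A AQ.
  have sA (Q0 : {set {set {set T}}}) B : partition Q0 D -> B \in Q0 -> D :\: (D :\: B) = B.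
    move=> hp hB; rewrite setDDr setDv set0U; apply/setIidPr.
    by rewrite -(cover_partition hp); exact: bigcup_sup.
  have /h1/h2[B BQ eB] : exists2 B, B \in Q1 & D :\: A = D :\: B by exists A.
  by rewrite -(sA _ _ p1 AQ) eB (sA _ _ p2 BQ).
by move=> h1 h2; apply/eqP; rewrite eqEsubset !sub.
Qed.

(** By uniqueness the parts are the coparallel classes, and [f] leaves the class of [e] when it lies
    in the core of [D :\ e]. The criterion is asymmetric in [e] and [f], so swapping them yields a
    second stress. *)
Lemma pblock_neqP k D Q e f : (0 < k)%N -> kfold_circuit p k D ->
  principal_partition p k D Q -> e \in D -> f \in D ->
  reflect (exists w, [/\ (w <= stress M D)%MS, coef w e = 0 & coef w f != 0])
          (pblock Q e != pblock Q f).
Proof.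
move=> k0 kD hQ eD fD.
rewrite (principal_partition_uniq hQ (coparallel_principal k0 kD)).
have /kfold_circuitP[cD nD] := kD.
have tI := partition_trivIset (coparallel_partition cD).
have pbE g : g \in D -> pblock (coparallel_classes M D) g = coparallel M D g.
  by move=> gD; apply: def_pblock; rewrite ?coparallel_id // imset_f.
rewrite !pbE //.
have -> : (coparallel M D e != coparallel M D f) = (f \in core M (D :\ e)).
  apply/idP/idP => [|h].
    apply: contraR => h; apply/eqP/esym; apply: coparallel_eq => //.
    by rewrite in_setD h fD.
  apply/eqP => h2; have := coparallel_id M fD; rewrite -h2.
  by rewrite in_setD h.
apply: (iffP (coreP _ _ _)) => [[w]|[w [h1 h2 h3]]].
  by rewrite stress_setD1 => /andP[h1 /eqP h2] h3; exists w.
by exists w => //; rewrite stress_setD1 h1 h2 eqxx.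
Qed.

End Framework.

(** * Generic realisations maximise the rank *)

Section GenericRank.
Local Open Scope ring_scope.
Variables (R : realType) (T : finType) (d : nat).
Implicit Types (F : {set {set T}}).

Let N := #|{: T * 'I_d}|.

Definition eval_mpoly (p : T -> 'rV[R]_d) (P : {mpoly rat[N]}) : R :=
  mmap (ratr : rat -> R) (coords p) P.

Definition coord_var (a : T) (c : 'I_d) : {mpoly rat[N]} := 'X_(enum_rank (a, c)).

Lemma eval_coord_var p a c : eval_mpoly p (coord_var a c) = p a 0 c.
Proof. by rewrite /eval_mpoly mmapX mmap1U /coords enum_rankK. Qed.

Definition rigidity_mpoly F : 'M[{mpoly rat[N]}]_(#|{: {set T}}|, N) :=
  \matrix_(i, j)
    let e := enum_val i in
    let ac := enum_val j in
    if (e \in F) && (ac.1 \in e) then coord_var ac.1 ac.2 - coord_var (other e ac.1) ac.2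
    else 0.

Lemma map_rigidity_mpoly p F :
  map_mx (eval_mpoly p) (rigidity_mpoly F) = rigidity_matrix p F.
Proof.
apply/matrixP => i j; rewrite !mxE /=; case: ifP => _; last by rewrite /eval_mpoly mmap0.
by rewrite /eval_mpoly mmapB -!/(eval_mpoly _ _) !eval_coord_var.
Qed.

Lemma det_eval_mpoly p n (A : 'M[{mpoly rat[N]}]_n) :
  \det (map_mx (eval_mpoly p) A) = eval_mpoly p (\det A).
Proof. exact: (det_map_mx (mmap (ratr : rat -> R) (coords p))). Qed.

(** A minor that is nonzero at [q] is a nonzero polynomial in the coordinates, hence nonzero at the
    generic [p]. *)
Lemma generic_rig_rank (p q : T -> 'rV[R]_d) F :
  generic p -> (rig_rank q F <= rig_rank p F)%N.
Proof.
move=> gp; pose A := rigidity_matrix q F.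
(* [f] picks a maximal independent set of rows and [g] then as many independent columns, giving an
   invertible submatrix of full rank order. *)
pose f := maxrankfun A; pose B := (rowsub f A)^T.
have fB : row_full B by rewrite /row_full mxrank_tr; exact: maxrowsub_free.
pose g := fullrankfun fB.
have hsub r : map_mx (eval_mpoly r) (mxsub f g (rigidity_mpoly F)) =
              mxsub f g (rigidity_matrix r F).
  by rewrite -map_rigidity_mpoly; apply/matrixP => i j; rewrite !mxE.
have hq : mxsub f g A \in unitmx.
  rewrite -unitmx_tr; have := fullrowsub_unit fB; rewrite -/g.
  suff -> : rowsub g B = (mxsub f g A)^T by [].
  by apply/matrixP => i j; rewrite !mxE.
have hp : mxsub f g (rigidity_matrix p F) \in unitmx.
  move: hq; rewrite /A -!hsub !unitmxE !det_eval_mpoly !unitfE => h.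
  apply: gp; apply: contraNneq h => ->; by rewrite /eval_mpoly mmap0.
rewrite {1}/rig_rank -/A -(mxrank_unit hp) -mxrank_tr.
have -> : (mxsub f g (rigidity_matrix p F))^T = rowsub g (rowsub f (rigidity_matrix p F))^T.
  by apply/matrixP => i j; rewrite !mxE.
by apply: leq_trans (mxrankS (rowsub_sub _ _)) _; rewrite mxrank_tr mxrankS ?rowsub_sub.
Qed.

Lemma generic_coord_neq (p : T -> 'rV[R]_d) (a b : T) (c : 'I_d) :
  generic p -> a != b -> p a 0 c != p b 0 c.
Proof.
move=> gp ab; rewrite -subr_eq0.
have := gp (coord_var a c - coord_var b c); rewrite -/(eval_mpoly _ _) /eval_mpoly mmapB.
rewrite -!/(eval_mpoly _ _) !eval_coord_var; apply.
rewrite subr_eq0; apply/eqP => /(congr1 (fun P : {mpoly rat[N]} => P@_U_(enum_rank (a, c)))).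
rewrite /coord_var !mcoeffX eqxx => /eqP.
suff /negbTE -> : U_(enum_rank (b, c))%MM != U_(enum_rank (a, c))%MM :> 'X_{1..N} by rewrite oner_eq0.
apply/eqP => /mnmP /(_ (enum_rank (a, c))); rewrite !mnm1E eqxx (inj_eq enum_rank_inj).
by case: eqP => // -[] /eqP; rewrite eq_sym (negbTE ab).
Qed.

Lemma generic_nullity (p q : T -> 'rV[R]_d) F : generic p ->
  (nullity (rigidity_matrix p setT) F <= nullity (rigidity_matrix q setT) F)%N.
Proof.
move=> gp; have := generic_rig_rank q F gp.
have := rig_rank_nullity p F; have := rig_rank_nullity q F; lia.
Qed.

End GenericRank.

(** * Equilibrium equations of a graph stress *)

Section GraphStress.
Local Open Scope ring_scope.
Variables (R : realType) (T : finType) (d : nat).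
Implicit Types (D F : {set {set T}}).

Lemma other_set2 (a b : T) : a != b -> other [set a; b] a = b.
Proof.
move=> ab; rewrite /other; case: pickP => [c|/(_ b)] /=.
  by rewrite !inE => /andP[/negbTE -> /eqP].
by rewrite !inE eqxx orbT andbT eq_sym ab.
Qed.

Lemma card2_edge (e : {set T}) a : #|e| = 2%N -> a \in e ->
  exists2 b, e = [set a; b] & a != b.
Proof.
move=> /eqP /cards2P[b [c [bc ->]]]; rewrite !inE => /orP[] /eqP ->.
  by exists c.
by exists b; [rewrite setUC | rewrite eq_sym].
Qed.

Lemma simple_neq D a b : simple_graph D -> [set a; b] \in D -> a != b.
Proof. by move=> sD /sD; rewrite cards2; case: (a != b). Qed.

Lemma sum_star (a : T) (h : {set T} -> R) :
  (forall e : {set T}, a \notin e -> h e = 0) -> (forall e : {set T}, #|e| != 2%N -> h e = 0) ->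
  \sum_e h e = \sum_b h [set a; b].
Proof.
(* The term [b = a] is the singleton of [a], at which [h] vanishes. *)
move=> h1 h2; rewrite [RHS](bigD1 a) //= setUid h2 ?cards1 // add0r.
rewrite (eq_bigl (mem [set~ a])); last by move=> b; rewrite !inE.
rewrite -(big_imset h (h := fun b => [set a; b])) /=; last first.
  move=> b c; rewrite !inE => ba ca /setP /(_ b); rewrite !inE eqxx orbT (negbTE ba) /=.
  by move/esym/eqP.
rewrite [LHS](bigID (mem [set [set a; b] | b in [set~ a]])) /= [X in _ + X]big1 ?addr0 //.
move=> e he; case: (boolP (a \in e)) => ae; last exact: h1.
apply: h2; apply: contra he => he.
have [b -> ab] := card2_edge (eqP he) ae.
by apply: imset_f; rewrite !inE eq_sym.
Qed.

Lemma graph_stressP (p : T -> 'rV[R]_d) D w : simple_graph D ->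
  (w <= stress (rigidity_matrix p setT) D)%MS <->
  (forall e, e \notin D -> coef w e = 0) /\
  (forall a c, \sum_b coef w [set a; b] * (p a 0 c - p b 0 c) = 0).
Proof.
move=> sD.
have key : (forall e, e \notin D -> coef w e = 0) -> forall a c,
  (w *m rigidity_matrix p setT) 0 (enum_rank (a, c)) =
  \sum_b coef w [set a; b] * (p a 0 c - p b 0 c).
  move=> h a c; rewrite mxE (reindex (@enum_rank {set T})) /=; last exact/onW_bij/enum_rank_bij.
  rewrite (@sum_star a).
  - apply: eq_bigr => b _; rewrite !mxE !enum_rankK /= in_setT !inE eqxx /=.
    have [->|ab] := eqVneq a b; last by rewrite other_set2.
    by rewrite subrr mulr0 -/(coef _ _) h ?mul0r // setUid; apply/negP => /sD; rewrite cards1.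
  - by move=> e ae; rewrite !mxE !enum_rankK /= (negbTE ae) andbF mulr0.
  - by move=> e he; rewrite -/(coef _ _) h ?mul0r //; apply: contra he => /sD ->.
split=> [/stressP[h1 h2]|[h1 h2]].
  by split=> // a c; rewrite -key // h2 mxE.
apply/stressP; split=> //; apply/rowP => j; rewrite -(enum_valK j).
by case: (enum_val j) => a c; rewrite key // h2 mxE.
Qed.

End GraphStress.

(** * Stresses of a cone compared with those of its base *)

Section Cone.
Local Open Scope ring_scope.
Variables (R : realType) (T : finType).
Implicit Types (D : {set {set T}}) (a b : T) (mu : T -> R).

Lemma mxrank_le_linear_inj (K : fieldType) m n m1 n1 (f : 'rV[K]_m -> 'rV[K]_n)
    (U : 'M_(m1, m)) (W : 'M_(n1, n)) : linear f ->
  (forall u, (u <= U)%MS -> (f u <= W)%MS) ->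
  (forall u, (u <= U)%MS -> f u = 0 -> u = 0) ->
  (\rank U <= \rank W)%N.
Proof.
move=> lf fUW f0.
pose g : {linear 'rV[K]_m -> 'rV[K]_n} := HB.pack f (GRing.isLinear.Build _ _ _ _ f lf).
have cap0 : (U :&: kermx (lin1_mx g))%MS = 0.
  apply/eqP; rewrite -submx0; apply/rV_subP => u; rewrite sub_capmx => /andP[uU /sub_kermxP].
  by rewrite mul_rV_lin1 => /f0 ->; rewrite ?sub0mx.
rewrite -(mxrank_mul_ker U (lin1_mx g)) cap0 mxrank0 addn0; apply: mxrankS.
apply/row_subP => i; rewrite row_mul mul_rV_lin1; apply: fUW; exact: row_sub.
Qed.

Lemma sum_option (F : option T -> R) : \sum_b F b = F None + \sum_b F (Some b).
Proof.
rewrite (bigD1 None) //=; congr (_ + _).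
rewrite (eq_bigl (mem [set Some b | b : T])); last first.
  case=> [b|] /=; first by rewrite imset_f.
  by apply/esym/negP => /imsetP[].
rewrite big_imset /=; last by move=> b c _ _ [].
by apply: eq_bigl => b; rewrite inE.
Qed.

Lemma imset_Some_inj : injective (fun e : {set T} => Some @: e : {set option T}).
Proof. by apply: imset_inj => b c []. Qed.

Lemma imset_Some2 a b : Some @: [set a; b] = [set Some a; Some b].
Proof. by rewrite imsetU1 imset_set1. Qed.

Lemma None_imset_Some (e : {set T}) : None \in Some @: e = false.
Proof. by apply/negP => /imsetP[]. Qed.

Lemma cone_edge D (e : {set T}) : (Some @: e \in cone D) = (e \in D).
Proof.
rewrite inE; apply/orP/idP => [[/imsetP[b _ h]|/imsetP[f fD /imset_Some_inj ->]] //|eD].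
  by have := None_imset_Some e; rewrite h !inE eqxx.
by right; apply: imset_f.
Qed.

Lemma cone_spoke D a : ([set None; Some a] \in cone D) = (a \in vertices D).
Proof.
rewrite inE; apply/orP/idP => [[/imsetP[b bD /setP /(_ (Some a))]|/imsetP[f fD h]]|aD].
- by rewrite !inE eqxx /= => /esym /eqP[->].
- by have := None_imset_Some f; rewrite -h !inE eqxx.
by left; apply: imset_f.
Qed.

Lemma simple_cone D : simple_graph D -> simple_graph (cone D).
Proof.
move=> sD e; rewrite inE => /orP[] /imsetP[b bD ->]; first by rewrite cards2.
by rewrite card_imset ?sD // => ? ? [].
Qed.

Lemma vertices_edge D a b : [set a; b] \in D -> a \in vertices D.
Proof. by move=> h; apply/bigcupP; exists [set a; b]; rewrite // !inE eqxx. Qed.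

Lemma coef_row (E : finType) (f : E -> R) e : coef (\row_i f (enum_val i)) e = f e.
Proof. by rewrite /coef mxE enum_rankK. Qed.

Definition spoke_load (s : 'rV[R]_#|{: {set T}}|) mu a : R :=
  \sum_z coef s [set a; z] * (mu a - mu z).

Variables (d : nat) (p : T -> 'rV[R]_d) (q : option T -> 'rV[R]_d.+1) (mu : T -> R).
Variable D : {set {set T}}.
Hypothesis sD : simple_graph D.
Hypothesis mu0 : forall a, mu a != 0.
(* Central projection from [q None] sends [q (Some a)] to the point [p a] of the
   affine hyperplane at height 1. *)
Hypothesis q_height : forall a, q (Some a) 0 ord0 - q None 0 ord0 = (mu a)^-1.
Hypothesis q_proj : forall a c,
  q (Some a) 0 (lift ord0 c) - q None 0 (lift ord0 c) = (mu a)^-1 * p a 0 c.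

Notation Sp := (stress (rigidity_matrix p setT) D).
Notation Sq := (stress (rigidity_matrix q setT) (cone D)).

(** The sum over a spoke has a single term, and the product over an edge [ab] is [mu a * mu b]; this
    form avoids naming the ends of [e]. *)
Definition cone_stress_coef (s : 'rV[R]_#|{: {set T}}|) (e : {set option T}) : R :=
  if e \in cone D then
    if None \in e then \sum_(a | Some a \in e) mu a * spoke_load s mu a
    else coef s (Some @^-1: e) * \prod_(a | Some a \in e) mu a
  else 0.

Definition cone_stress (s : 'rV[R]_#|{: {set T}}|) : 'rV[R]_#|{: {set option T}}| :=
  \row_i cone_stress_coef s (enum_val i).

Lemma cone_stress_linear : linear cone_stress.
Proof.
move=> k s t; apply/rowP => i; rewrite !mxE /cone_stress_coef.
case: ifP => _; last by rewrite mulr0 addr0.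
case: ifP => _; last by rewrite /coef !mxE; ring.
rewrite mulr_sumr -big_split /=; apply: eq_bigr => a _.
rewrite /spoke_load mulrCA -mulrDr; congr (_ * _).
rewrite mulr_sumr -big_split /=; apply: eq_bigr => z _.
by rewrite /coef !mxE; ring.
Qed.

Lemma cone_stress_edge s a b : (s <= Sp)%MS ->
  coef (cone_stress s) [set Some a; Some b] = coef s [set a; b] * (mu a * mu b).
Proof.
move=> /(graph_stressP _ _ sD)[s0 _].
rewrite /cone_stress coef_row /cone_stress_coef -imset_Some2 cone_edge None_imset_Some.
case: ifP => [abD|/negbT /s0 ->]; last by rewrite mul0r.
congr (coef s _ * _).
  by apply/setP => c; rewrite inE mem_imset // => ? ? [].
have ab := simple_neq sD abD.
rewrite (eq_bigl (mem [set a; b])); last by move=> c; rewrite mem_imset // => ? ? [].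
by rewrite big_setU1 ?inE //= big_set1.
Qed.

Lemma cone_stress_spoke s a : (s <= Sp)%MS ->
  coef (cone_stress s) [set None; Some a] = mu a * spoke_load s mu a.
Proof.
move=> /(graph_stressP _ _ sD)[s0 _].
rewrite /cone_stress coef_row /cone_stress_coef cone_spoke !inE eqxx /=.
case: ifP => [_|/negbT aD]; first by rewrite (big_pred1 a) // => b; rewrite !inE.
rewrite /spoke_load big1 ?mulr0 // => z _; rewrite s0 ?mul0r //.
by apply: contra aD => /vertices_edge.
Qed.

(** The homogeneous coordinates [(1, p a)]. A stress of [p] balances them too, as the added
    coordinate is constant. *)
Let P a c := mu a * (q (Some a) 0 c - q None 0 c).

Let qP a c : q (Some a) 0 c = q None 0 c + (mu a)^-1 * P a c.
Proof. by rewrite /P mulrA mulVf // mul1r addrC subrK. Qed.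

Let stress_P s a c : (s <= Sp)%MS -> \sum_b coef s [set a; b] * (P a c - P b c) = 0.
Proof.
move=> /(graph_stressP _ _ sD)[_ h]; rewrite /P; case: (unliftP ord0 c) => [c'|] ->.
  rewrite -[RHS](h a c'); apply: eq_bigr => b _; rewrite !q_proj !mulrA.
  by rewrite !mulfV // !mul1r.
by rewrite big1 // => b _; rewrite !q_height !mulfV // subrr mulr0.
Qed.

Lemma cone_stress_in s : (s <= Sp)%MS -> (cone_stress s <= Sq)%MS.
Proof.
move=> hs; have sP a c := stress_P a c hs.
apply/(graph_stressP _ _ (simple_cone sD)); split.
  by move=> e /negbTE he; rewrite /cone_stress coef_row /cone_stress_coef he.
move=> [a|] c; rewrite sum_option.
  rewrite setUC cone_stress_spoke //.
  under eq_bigr => b _ do rewrite cone_stress_edge // !qP.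
  have e1 : mu a * spoke_load s mu a * (q (Some a) 0 c - q None 0 c) =
      \sum_b coef s [set a; b] * (mu a - mu b) * P a c.
    by rewrite mulrAC mulrC -/(P a c) /spoke_load mulr_suml.
  (* At [Some a], the edge term [mu b * P a - mu a * P b] and the spoke term [(mu a - mu b) * P a]
     add up to [mu a * (P a - P b)]. *)
  transitivity (mu a * \sum_b coef s [set a; b] * (P a c - P b c)); last by rewrite sP mulr0.
  rewrite e1 -big_split mulr_sumr; apply: eq_bigr => b _.
  move: (mu0 a) (mu0 b) (P a c) (P b c) => ? ? ? ?.
  by rewrite /=; field; apply/andP.
rewrite subrr mulr0 add0r.
under eq_bigr => b _ do rewrite cone_stress_spoke //.
have e1 a : mu a * spoke_load s mu a * (q None 0 c - q (Some a) 0 c) =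
    - (\sum_b coef s [set a; b] * (mu a * P a c)) + \sum_b coef s [set a; b] * (mu b * P a c).
  rewrite -sumrN -big_split /= -opprB mulrN mulrAC mulrC -/(P a c) /spoke_load mulr_suml -sumrN.
  by apply: eq_bigr => b _; ring.
under eq_bigr => b _ do rewrite e1.
(* At the apex, exchanging the names of [a] and [b] in the second double sum leaves [mu a] times the
   equilibrium equation at [a]. *)
rewrite big_split /= sumrN [X in _ + X]exchange_big /= addrC -sumrB.
apply: big1 => a _.
transitivity (- mu a * \sum_b coef s [set a; b] * (P a c - P b c)); last by rewrite sP mulr0.
rewrite -sumrB mulr_sumr.
by apply: eq_bigr => b _; rewrite [[set b; a]]setUC; ring.
Qed.

Definition uncone_stress (w : 'rV[R]_#|{: {set option T}}|) : 'rV[R]_#|{: {set T}}| :=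
  \row_i (let e : {set T} := enum_val i in (\prod_(a in e) (mu a)^-1) * coef w (Some @: e)).

Lemma uncone_stress_linear : linear uncone_stress.
Proof. by move=> k s t; apply/rowP => i; rewrite !mxE /coef !mxE; ring. Qed.

Lemma coef_uncone w e :
  coef (uncone_stress w) e = (\prod_(a in e) (mu a)^-1) * coef w (Some @: e).
Proof. exact: (coef_row (fun e : {set T} => (\prod_(a in e) (mu a)^-1) * coef w (Some @: e))). Qed.

Lemma uncone_stress_in w : (w <= Sq)%MS -> (uncone_stress w <= Sp)%MS.
Proof.
move=> /(graph_stressP _ _ (simple_cone sD))[w0 w1].
have u0 e : e \notin D -> coef (uncone_stress w) e = 0.
  by move=> eD; rewrite coef_uncone w0 ?mulr0 // cone_edge.
apply/(graph_stressP _ _ sD); split=> // a c.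
have h1 := w1 (Some a) (lift ord0 c); have h0 := w1 (Some a) ord0.
rewrite !sum_option q_height in h0; rewrite !sum_option q_proj in h1.
have : \sum_b coef w [set Some a; Some b] * ((mu b)^-1 * (p a 0 c - p b 0 c)) = 0.
  (* Subtracting [p a 0 c] times the height equation from the equation of coordinate [c] eliminates
     the spoke. *)
  have := congr2 (fun y z => z - p a 0 c * y) h0 h1.
  rewrite /= mulr0 subr0 => {h0 h1}h; rewrite -[RHS]h [p a 0 c * (_ + _)]mulrDr mulr_sumr opprD addrACA.
  rewrite [X in X + _](_ : _ = 0) ?add0r; last by ring.
  rewrite -sumrB; apply: eq_bigr => b _.
  have e1 : q (Some a) 0 ord0 - q (Some b) 0 ord0 = (mu a)^-1 - (mu b)^-1.
    by rewrite -!q_height; ring.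
  have e2 : q (Some a) 0 (lift ord0 c) - q (Some b) 0 (lift ord0 c) =
            (mu a)^-1 * p a 0 c - (mu b)^-1 * p b 0 c by rewrite -!q_proj; ring.
  by rewrite e1 e2; ring.
move/(congr1 (fun y => (mu a)^-1 * y)) => /=; rewrite mulr0 => h.
rewrite -[RHS]h mulr_sumr; apply: eq_bigr => b _.
case: (boolP ([set a; b] \in D)) => abD; last first.
  by rewrite u0 // mul0r -imset_Some2 w0 ?cone_edge // mul0r mulr0.
have ab := simple_neq sD abD.
by rewrite coef_uncone big_setU1 ?inE //= big_set1 imset_Some2; ring.
Qed.

Lemma nullity_cone : nullity (rigidity_matrix q setT) (cone D) =
                     nullity (rigidity_matrix p setT) D.
Proof.
apply/eqP; rewrite eqn_leq; apply/andP; split.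
  apply: (mxrank_le_linear_inj uncone_stress_linear uncone_stress_in) => w hw u0.
  have /(graph_stressP _ _ (simple_cone sD))[w0 w1] := hw.
  have e0 (e : {set T}) : coef w (Some @: e) = 0.
    apply/eqP; have /eqP := coef_uncone w e; rewrite u0 {1}/coef mxE eq_sym mulf_eq0.
    by case/orP => // /prodf_eq0[a _]; rewrite invr_eq0 (negbTE (mu0 a)).
  apply: coef_inj => e; rewrite [RHS]mxE; case: (boolP (e \in cone D)) => [|/w0 //].
  rewrite inE => /orP[] /imsetP[a _ ->] //.
  (* Once the edges of [D] carry nothing, only the spoke acts at [Some a], with nonzero height
     [(mu a)^-1]. *)
  have := w1 (Some a) ord0; rewrite sum_option big1 ?addr0 => [|b _].
    rewrite q_height setUC => /eqP; rewrite mulf_eq0 invr_eq0 (negbTE (mu0 a)) orbF.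
    by move/eqP.
  by rewrite -imset_Some2 e0 mul0r.
apply: (mxrank_le_linear_inj cone_stress_linear cone_stress_in) => s hs u0.
have /(graph_stressP _ _ sD)[s0 s1] := hs.
apply: coef_inj => e; rewrite [RHS]mxE; case: (boolP (e \in D)) => [eD|/s0 //].
have /eqP/cards2P[a [b [ab ee]]] := sD eD; rewrite ee.
have /eqP := cone_stress_edge a b hs; rewrite u0 {1}/coef mxE eq_sym !mulf_eq0.
by rewrite !(negbTE (mu0 _)) !orbF => /eqP.
Qed.

End Cone.

(** * The cone as a k-fold circuit, and the parts of its spokes *)

Section ConeParts.
Local Open Scope ring_scope.
Variables (R : realType) (T : finType).
Implicit Types (D : {set {set T}}) (a b : T) (mu : T -> R).

Lemma nullity_setD2 (K : fieldType) (E : finType) n (M : 'M[K]_(#|E|, n))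
    (F : {set E}) (e f : E) s t :
  (s <= stress M F)%MS -> (t <= stress M F)%MS ->
  coef s e * coef t f != coef s f * coef t e ->
  ((nullity M (F :\ e :\ f)).+2 <= nullity M F)%N.
Proof.
move=> hs ht ne.
have he : (nullity M (F :\ e) < nullity M F)%N.
  apply/nullity_setD1_ltP; case: (eqVneq (coef s e) 0) => hse; last by exists s.
  case: (eqVneq (coef t e) 0) => hte; last by exists t.
  by move: ne; rewrite hse hte mul0r mulr0 eqxx.
apply: leq_ltn_trans he; apply/nullity_setD1_ltP.
(* This combination vanishes at [e], and its value at [f] is the nonzero minor. *)
exists (coef s e *: t - coef t e *: s).
  rewrite stress_setD1; apply/andP; split.
    by rewrite addmx_sub ?scalemx_sub // -scaleNr scalemx_sub.
  by rewrite /coef !mxE; apply/eqP; ring.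
by move: ne; rewrite -subr_eq0 /coef !mxE [t 0 _ * s 0 (enum_rank f)]mulrC.
Qed.

Lemma spoke_loadD s mu1 mu2 a :
  spoke_load s (fun b => mu1 b + mu2 b) a = spoke_load s mu1 a + spoke_load s mu2 a.
Proof. by rewrite /spoke_load -big_split /=; apply: eq_bigr => b _; ring. Qed.

Lemma spoke_loadZ s k mu a : spoke_load s (fun b => k * mu b) a = k * spoke_load s mu a.
Proof. by rewrite /spoke_load mulr_sumr; apply: eq_bigr => b _; ring. Qed.

Lemma spoke_load_const (s : 'rV[R]_#|{: {set T}}|) (k : R) a : spoke_load s (fun=> k) a = 0.
Proof. by rewrite /spoke_load big1 // => b _; rewrite subrr mulr0. Qed.

Lemma spoke_load_delta (s : 'rV[R]_#|{: {set T}}|) a z : a != z ->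
  spoke_load s (fun b => (b == z)%:R) a = - coef s [set a; z].
Proof.
move=> az; rewrite /spoke_load (bigD1 z) //= eqxx (negbTE az) sub0r mulrN1.
by rewrite big1 ?addr0 // => b /negbTE ->; rewrite subr0 mulr0.
Qed.

(** The apex is the origin and [a] is placed at [(mu a)^-1] times [(1, p a)]. *)
Definition cone_realisation d (p : T -> 'rV[R]_d) mu (w : option T) : 'rV[R]_d.+1 :=
  if w is Some a then
    \row_c (if unlift ord0 c is Some c' then (mu a)^-1 * p a 0 c' else (mu a)^-1)
  else 0.

Lemma cone_realisation_height d (p : T -> 'rV[R]_d) mu a :
  cone_realisation p mu (Some a) 0 ord0 - cone_realisation p mu None 0 ord0 = (mu a)^-1.
Proof. by rewrite !mxE unlift_none subr0. Qed.

Lemma cone_realisation_proj d (p : T -> 'rV[R]_d) mu a c :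
  cone_realisation p mu (Some a) 0 (lift ord0 c) - cone_realisation p mu None 0 (lift ord0 c) =
  (mu a)^-1 * p a 0 c.
Proof. by rewrite !mxE liftK subr0. Qed.

Variables (d k : nat) (p : T -> 'rV[R]_d) (q : option T -> 'rV[R]_d.+1).
Variables (D : {set {set T}}) (A : {set {set {set T}}}).
Hypotheses (k0 : (0 < k)%N) (gp : generic p) (gq : generic q) (sD : simple_graph D).
Hypotheses (kD : kfold_circuit p k D) (hA : principal_partition p k D A).

Notation Sp := (stress (rigidity_matrix p setT) D).
Notation nul_q := (nullity (rigidity_matrix q setT)).
Notation nul_c mu := (nullity (rigidity_matrix (cone_realisation p mu) setT)).

Lemma nullity_cone_realisation mu : (forall a, mu a != 0) -> nul_c mu (cone D) = k.
Proof.
move=> mu0; case/(kfold_circuitP p k D): kD => _ <-.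
apply: (nullity_cone sD mu0).
  exact: cone_realisation_height.
exact: cone_realisation_proj.
Qed.

(* The projection of [q] from the apex need not be generic, but it can only have
   more stresses than [p]; this suffices for the lower bound. *)
Lemma nullity_cone_generic : nul_q (cone D) = k.
Proof.
apply/eqP; rewrite eqn_leq; apply/andP; split.
  rewrite -(@nullity_cone_realisation (fun=> 1)); last by move=> a; rewrite oner_eq0.
  exact: generic_nullity.
pose mu a := (q (Some a) 0 ord0 - q None 0 ord0)^-1.
have mu0 a : mu a != 0 by rewrite invr_eq0 subr_eq0 generic_coord_neq.
pose p' a : 'rV[R]_d := \row_c (mu a * (q (Some a) 0 (lift ord0 c) - q None 0 (lift ord0 c))).
rewrite (@nullity_cone _ _ _ p' q mu D sD mu0).
- by case/(kfold_circuitP p k D): kD => _ <-; exact: generic_nullity.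
- by move=> a; rewrite invrK.
- by move=> a c; rewrite mxE mulrA mulVf // mul1r.
Qed.

Lemma cone_stress_realisation mu s : (forall a, mu a != 0) -> (s <= Sp)%MS ->
  (cone_stress mu D s <= stress (rigidity_matrix (cone_realisation p mu) setT) (cone D))%MS.
Proof.
move=> mu0; apply: (cone_stress_in sD mu0).
  exact: cone_realisation_height.
exact: cone_realisation_proj.
Qed.

(** For each edge [e], a special realisation with a cone stress nonzero at [e] has nullity below [k]
    after deleting [e]; the generic nullity is no larger. *)
Lemma kfold_circuit_cone : kfold_circuit q k (cone D).
Proof.
have [cD _] := (kfold_circuitP p k D).1 kD.
apply/kfold_circuitP; split; last exact: nullity_cone_generic.
apply/eqP; rewrite eqEsubset core_sub /=; apply/subsetP => e eC.
rewrite inE eC nullity_cone_generic /=.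
suff [mu mu0 [s hs he]] : exists2 mu : T -> R, forall a, mu a != 0 &
    exists2 s, (s <= Sp)%MS & coef (cone_stress mu D s) e != 0.
  rewrite -(nullity_cone_realisation mu0); apply: leq_ltn_trans (generic_nullity _ _ gq) _.
  by apply: nullity_setD1_lt he; exact: cone_stress_realisation.
have sp_stress f : f \in D -> exists2 s, (s <= Sp)%MS & coef s f != 0.
  by rewrite -{1}cD => /coreP.
move: eC; rewrite inE => /orP[] /imsetP[].
  move=> a /bigcupP[f fD af] ->.
  have [b ef ab] := card2_edge (sD fD) af.
  have [s hs hf] := sp_stress f fD.
  (* With this [mu] the load of the spoke at [a] is minus the coefficient of [s] at [ab]. *)
  exists (fun c => 1 + (c == b)%:R).
    by move=> c; rewrite nat1r pnatr_eq0.
  exists s => //; rewrite (cone_stress_spoke _ sD _ hs) (negbTE ab) addr0 mul1r.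
  by rewrite spoke_loadD spoke_load_const spoke_load_delta // add0r oppr_eq0 -ef.
move=> f fD ->; have [s hs hf] := sp_stress f fD.
exists (fun=> 1); first by move=> a; rewrite oner_eq0.
exists s => //; have /eqP/cards2P[a [b [ab ef]]] := sD fD.
by rewrite ef imset_Some2 (cone_stress_edge _ sD _ _ hs) !mulr1 -ef.
Qed.

(** Independence of [L_u] and [L_x] on the stresses of [D], expressed by a nonzero two by two
    minor. *)
Definition spokes_independent u x := exists mu s t,
  [/\ forall a : T, mu a != 0 :> R, (s <= Sp)%MS, (t <= Sp)%MS &
      spoke_load s mu u * spoke_load t mu x != spoke_load s mu x * spoke_load t mu u].

Lemma spokes_independentC u x : spokes_independent u x -> spokes_independent x u.
Proof. by case=> mu [s [t [h1 h2 h3 h4]]]; exists mu, s, t; split; rewrite // eq_sym. Qed.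

(** [s] vanishes at [uz] but not at [xz], and [t] the other way round, so the minor is
    antidiagonal. *)
Lemma spokes_independent_common u x z : [set u; z] \in D -> [set x; z] \in D ->
  pblock A [set u; z] != pblock A [set x; z] -> spokes_independent u x.
Proof.
move=> uz xz ne; have [uz' xz'] := (simple_neq sD uz, simple_neq sD xz).
have /(pblock_neqP k0 kD hA uz xz)[s [hs su sx]] := ne.
have /(pblock_neqP k0 kD hA xz uz)[t [ht tx tu]] : pblock A [set x; z] != pblock A [set u; z].
  by rewrite eq_sym.
exists (fun b => 1 + (b == z)%:R), s, t; split=> //.
  by move=> c; rewrite nat1r pnatr_eq0.
rewrite !spoke_loadD !spoke_load_const !spoke_load_delta // su tx !add0r oppr0 mul0r.
by rewrite mulrNN eq_sym mulf_eq0 negb_or sx.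
Qed.

Lemma spokes_independent_private u x z : technicolour D A x ->
  [set u; z] \in D -> [set x; z] \notin D -> z != x -> spokes_independent u x.
Proof.
case=> e1 [e2 [e1D e2D xe1 xe2 ne]] uz xz zx; have uz' := simple_neq sD uz.
(* Two edges at [x] lie in different parts, so one of them lies outside the part of [uz]. *)
have [e [eD xe ne']] : exists e, [/\ e \in D, x \in e & pblock A e != pblock A [set u; z]].
  case: (eqVneq (pblock A e1) (pblock A [set u; z])) => h; last by exists e1.
  by exists e2; rewrite -h eq_sym.
have [y ee xy] := card2_edge (sD eD) xe; rewrite {}ee {xe} in eD ne'.
have /(pblock_neqP k0 kD hA eD uz)[t [ht tx tu]] := ne'.
have /(pblock_neqP k0 kD hA uz eD)[s [hs su sx]] : pblock A [set u; z] != pblock A [set x; y].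
  by rewrite eq_sym.
have xz0 w : (w <= Sp)%MS -> coef w [set x; z] = 0 by case/stressP => h _; exact: h.
(* As [xz] is not an edge, [L_x] does not depend on [r]. The vertex [y] may be [u], so [L_u] at
   [r = 0] is left unevaluated. *)
pose mu (r : nat) b : R := (1 + (b == y)%:R) + r%:R * (b == z)%:R.
have mu0 r a : mu r a != 0 by rewrite /mu -natrM nat1r -natrD pnatr_eq0.
have loadx w r : (w <= Sp)%MS -> spoke_load w (mu r) x = - coef w [set x; y].
  move=> hw; rewrite /mu !spoke_loadD spoke_loadZ spoke_load_const !spoke_load_delta ?xz0 //.
    by rewrite oppr0 mulr0 addr0 add0r.
  by rewrite eq_sym.
(* [L_x] vanishes at [t] but not at [s], so it remains to make [L_u] nonzero at [t]. Passing from
   [r = 0] to [r = 1] shifts it by the nonzero [- coef t [set u; z]]. *)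
pose r : nat := spoke_load t (mu 0) u == 0.
exists (mu r), s, t; split=> //.
rewrite !loadx // tx oppr0 mulr0 eq_sym mulf_eq0 oppr_eq0 (negbTE sx) /=.
have -> : spoke_load t (mu r) u = spoke_load t (mu 0) u - r%:R * coef t [set u; z].
  by rewrite /mu !spoke_loadD !spoke_loadZ !(spoke_load_delta _ uz') mul0r addr0 mulrN.
rewrite /r; case: (spoke_load t (mu 0) u =P 0) => [->|/eqP h]; last by rewrite mul0r subr0.
by rewrite sub0r mul1r oppr_eq0.
Qed.

(** Deleting both spokes lowers the nullity by two in the special realisation, hence also in the
    generic one. Some stress then vanishes at the first spoke and not at the second. *)
Lemma cone_spokes_pblock_neq Q u x : u \in vertices D -> x \in vertices D ->
  principal_partition q k (cone D) Q -> spokes_independent u x ->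
  pblock Q [set None; Some u] != pblock Q [set None; Some x].
Proof.
move=> uD xD hQ [mu [s [t [mu0 hs ht ne]]]].
have kC := kfold_circuit_cone.
have [cC nC] := (kfold_circuitP q k (cone D)).1 kC.
have uC : [set None; Some u] \in cone D by rewrite cone_spoke.
have xC : [set None; Some x] \in cone D by rewrite cone_spoke.
apply/(pblock_neqP k0 kC hQ uC xC).
suff /nullity_setD1_ltP[w] : (nul_q (cone D :\ [set None; Some u] :\ [set None; Some x]) <
    nul_q (cone D :\ [set None; Some u]))%N.
  by rewrite stress_setD1 => /andP[hw /eqP wu] wx; exists w.
rewrite -ltnS -(nullity_core_setD1 cC uC) nC -(nullity_cone_realisation mu0).
apply: leq_trans (nullity_setD2 (cone_stress_realisation mu0 hs) (cone_stress_realisation mu0 ht) _).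
  by rewrite !ltnS; exact: generic_nullity.
rewrite !(cone_stress_spoke _ sD _ hs) !(cone_stress_spoke _ sD _ ht).
(* The minor of the cone stresses is that of the loads times [mu u * mu x]. *)
apply: contraNneq ne => h; apply/eqP; apply: (mulfI (mu0 u)); apply: (mulfI (mu0 x)).
by move: h; set a := spoke_load s mu u; set b := spoke_load t mu x => h; ring: h.
Qed.

End ConeParts.

Theorem theorem4p3 (R : realType) (T : finType) (d k : nat)
    (p : T -> 'rV[R]_d) (q : option T -> 'rV[R]_d.+1)
    (D : {set {set T}}) (A : {set {set {set T}}}) (u x : T) :
  (1 <= d)%N -> (1 <= k)%N ->
  generic p -> generic q ->
  simple_graph D ->
  kfold_circuit p k D ->
  principal_partition p k D A ->
  technicolour D A u -> technicolour D A x ->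
  ((exists z, [/\ z \in nbhd D u, z \in nbhd D x &
                  pblock A [set u; z] != pblock A [set x; z]])
   \/ nbhd D u :\ x != nbhd D x :\ u) ->
  (exists Q, principal_partition q k (cone D) Q) /\
  forall Q, principal_partition q k (cone D) Q ->
    pblock Q [set None; Some u] != pblock Q [set None; Some x].
Proof.
move=> _ k0 gp gq sD kD hA tu tx hyp; split.
  by eexists; apply: (coparallel_principal k0 (kfold_circuit_cone gp gq sD kD)).
have tv y : technicolour D A y -> y \in vertices D.
  by case=> e [_ [eD _ ye _ _]]; apply/bigcupP; exists e.
move=> Q hQ; apply: (cone_spokes_pblock_neq k0 gp gq sD kD (tv _ tu) (tv _ tx) hQ).
case: hyp => [[z]|/eqP/setP nN].
  by rewrite !inE => -[]; exact: (spokes_independent_common k0 sD kD hA).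
have private y y' z : technicolour D A y' -> z \in nbhd D y :\ y' -> z \notin nbhd D y' :\ y ->
    spokes_independent p D y y'.
  rewrite !inE => ty' /andP[zy' yz] nz.
  have yz' := simple_neq sD yz.
  apply: (spokes_independent_private k0 sD kD hA ty' yz _ zy').
  (* Since [z] differs from [y], its absence from the punctured neighbourhood of [y'] means that it
     is not adjacent to [y']. *)
  by move: nz; rewrite eq_sym yz'.
have [z hz] : exists z, (z \in nbhd D u :\ x) != (z \in nbhd D x :\ u).
  by apply/existsP; apply: contra_notT nN => /existsPn h z; apply/eqP; have := h z; rewrite negbK.
case: (boolP (z \in nbhd D u :\ x)) hz => zu; case: (boolP (z \in nbhd D x :\ u)) => zx //= _.
  exact: private zu zx.
by apply: spokes_independentC; exact: private zx zu.
Qed.
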